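(* Let $m,n$ be positive integers and let $\mathcal{A}$ and $\mathcal{B}$ be intervals of residue classes modulo $m$ and $n$, respectively. Let $g=\gcd(m,n)$, and let $h$ denote the number of solutions modulo $mn/g$ of the linear system \[ x\equiv a \pmod m,\qquad x\equiv b\pmod n \] as $(a,b)$ ranges over $\mathcal{A}\times\mathcal{B}$, i.e. $h$ is the number of residue classes $x$ modulo $mn/g$ with $x\bmod m\in\mathcal{A}$ and $x\bmod n\in\mathcal{B}$. Write \[ |\mathcal{A}|=Ag+r_A,\quad 0\le r_A<g,\qquad |\mathcal{B}|=Bg+r_B,\quad 0\le r_B<g, \] with $A,B$ non-negative integers. Then \[ h\ge ABg+Ar_B+Br_A+\max(0,r_A+r_B-g). \]
   Context: An interval of residue classes modulo $m$ is a set of the form $\{c,c+1,\ldots,c+L-1\}\bmod m\subseteq\mathbb{Z}/m\mathbb{Z}$ for some integer $c$ and some integer $0\le L\le m$ (consecutive residues, taken cyclically); its size is $L$. The integers $A,B$ in the claim are distinct from the sets $\mathcal{A},\mathcal{B}$. *)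

(* Defs.v *)
From HB Require Import structures.
From mathcomp Require Import all_boot all_order all_algebra.

Set Implicit Arguments.
Unset Strict Implicit.
Unset Printing Implicit Defensive.

Import Order.TTheory GRing.Theory Num.Theory.

(* Residue classes modulo m are encoded by their representatives in 'I_m
   (rather than 'Z_m, which is Z/2Z when m = 1). *)
Definition residue_interval (m : nat) (S : {set 'I_m}) : Prop :=
  exists (c : int) (L : nat),
    (L <= m)%N /\
    S = [set x : 'I_m | [exists i : 'I_L, ((x : nat)%:Z == c + (i : nat)%:Z %[mod m%:Z])%Z]].

Definition solution_set (m n : nat) (SA : {set 'I_m}) (SB : {set 'I_n}) :
    {set 'I_(m * n %/ gcdn m n)} :=
  [set x : 'I_(m * n %/ gcdn m n) |
     [exists a in SA, exists b in SB, (x == a %[mod m]) && (x == b %[mod n])]].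

(* Main.v *)
(** Reducing a solution [x] modulo [m] and [n] hits, by the Chinese remainder
    theorem, every pair [(a, b)] of [SA * SB] with [a = b] modulo [g]. Counting
    these pairs by their class [t] modulo [g] gives [\sum_t alpha t * beta t],
    where [alpha t = A + u t] and [beta t = B + v t] count the elements of [SA]
    and [SB] in the class [t]. For intervals, [u] and [v] only take the values
    [0] and [1], and they sum to [rA] and [rB]; conclude with
    [u v >= max 0 (u + v - 1)]. *)
Require Import Defs.
From HB Require Import structures.
From mathcomp Require Import all_boot all_order all_algebra.
From mathcomp Require Import zify.

Set Implicit Arguments.
Unset Strict Implicit.
Unset Printing Implicit Defensive.

Import Order.TTheory GRing.Theory Num.Theory.
Local Open Scope ring_scope.

(** For [a <= b], write [b - a = k * g] and take a Bezout relation [u * m = v * n + g]: then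
    [a + k * u * m = b + k * v * n] is a common solution. The case [b <= a] follows by exchanging
    the two moduli. *)
Lemma chinese_gcd (m n a b : nat) : (0 < m)%N -> (0 < n)%N ->
  a = b %[mod gcdn m n] ->
  exists x, x = a %[mod m] /\ x = b %[mod n].
Proof.
wlog le_ab: m n a b / (a <= b)%N.
  move=> W hm hn hab; case: (leqP a b) => [/W|/ltnW /W]; first exact.
  move=> /(_ n m hn hm); rewrite gcdnC => /(_ (esym hab)) [x [xb xa]].
  by exists x.
move=> hm hn /esym /eqP; rewrite eqn_mod_dvd // => /dvdnP[k def_k].
case: (egcdnP n hm) => u v def_u _.
exists (a + k * u * m)%N; split; first by rewrite -modnDmr modnMl addn0.
have -> : (a + k * u * m = b + k * v * n)%N.
  by rewrite -mulnA def_u mulnDr -def_k addnCA subnKC // addnC mulnA.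
by rewrite -modnDmr modnMl addn0.
Qed.

Lemma sum_residue_period (g t d : nat) : (t < g)%N ->
  (\sum_(d <= i < d + g) (i %% g == t) = 1)%N.
Proof.
move=> lt_tg; elim: d => [|d IHd].
  rewrite add0n big_mkord (bigD1 (Ordinal lt_tg)) //= modn_small // eqxx.
  rewrite big1 ?addn0 // => i; rewrite -val_eqE /= modn_small //.
  by move/negPf->.
have hg : (d < d + g)%N by lia.
(* Moving the window from [d] to [d.+1] trades the index [d] for [d + g], which has the same
   residue. *)
rewrite addSn big_nat_recr //= modnDr addnC.
by rewrite -IHd [RHS]big_ltn.
Qed.

Lemma sum_residue_periods (g t c q : nat) : (t < g)%N ->
  (\sum_(c <= i < c + q * g) (i %% g == t) = q)%N.
Proof.
move=> lt_tg; elim: q => [|q IHq]; first by rewrite mul0n addn0 big_geq.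
rewrite mulSnr addnA (@big_cat_nat _ _ _ (c + q * g)) ?leq_addr //=.
by rewrite IHq sum_residue_period // addn1.
Qed.

(** The window lies between windows of [q] and of [q.+1] full periods with the same start. *)
Lemma sum_residue_bounds (g t c q r : nat) : (t < g)%N -> (r < g)%N ->
  (q <= \sum_(c <= i < c + (q * g + r)) (i %% g == t) <= q.+1)%N.
Proof.
move=> lt_tg lt_rg; apply/andP; split.
  rewrite addnA (@big_cat_nat _ _ _ (c + q * g)) ?leq_addr //=.
  by rewrite sum_residue_periods // leq_addr.
rewrite -[leqRHS](@sum_residue_periods g t c) //.
rewrite [leqRHS](@big_cat_nat _ _ _ (c + (q * g + r))) ?leq_addr //=.
by rewrite leq_add2l mulSnr leq_add2l ltnW.
Qed.

(** Unrolls a cyclic interval into a window of consecutive naturals. As [L <= m], the map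
    [i |-> d + i] modulo [m] is injective on ['I_L], so the window has length [#|S|]. *)
Lemma residue_intervalE (m : nat) (S : {set 'I_m}) : (0 < m)%N ->
  residue_interval S ->
  exists c, forall F : nat -> nat,
    (\sum_(a in S) F a = \sum_(c <= i < c + #|S|) F (i %% m))%N.
Proof.
move=> hm [c [L [leLm defS]]].
have m0 : m%:Z != 0 by lia.
(* The start [c] may be negative; [d] is its representative in [[0, m)]. *)
pose d := `|(c %% m%:Z)%Z|%N.
have defd : d%:Z = (c %% m%:Z)%Z by rewrite /d gez0_abs // modz_ge0.
pose f (i : 'I_L) : 'I_m := Ordinal (ltn_pmod (d + i) hm).
have inj_f : injective f.
  move=> i j /(congr1 val) /= /eqP; rewrite eqn_modDl.
  rewrite !modn_small ?(leq_trans (ltn_ord _) leLm) // => /eqP.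
  exact: val_inj.
have {}defS : S = [set f i | i : 'I_L].
  apply/setP=> x; rewrite defS inE; apply/existsP/imsetP.
    move=> [i /eqP e]; exists i => //; apply: val_inj => /=.
    move: e; rewrite -modzDml -defd -PoszD !modz_nat => -[].
    by rewrite modn_small.
  move=> [i _ ->]; exists i; apply/eqP => /=.
  by rewrite -modzDml -defd -PoszD !modz_nat modn_mod.
have cardS : #|S| = L by rewrite defS card_imset // card_ord.
exists d => F; rewrite cardS defS big_imset /=; last by move=> i j _ _; apply: inj_f.
rewrite -[in RHS](add0n d) big_addn add0n addKn big_mkord.
by apply: eq_bigr => i _; rewrite addnC.
Qed.

(** Since [g] divides [m], wrapping around modulo [m] preserves classes modulo [g], so the unrolled
    window can be used. *)
Lemma residue_interval_class_bounds (m g : nat) (S : {set 'I_m}) (q r t : nat) :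
  (0 < m)%N -> residue_interval S -> (g %| m)%N ->
  #|S| = (q * g + r)%N -> (r < g)%N -> (t < g)%N ->
  (q <= \sum_(a in S) ((a : nat) %% g == t) <= q.+1)%N.
Proof.
move=> hm hS dvd_gm cS hr ht; have [c E] := residue_intervalE hm hS.
rewrite (E (fun a => (a %% g == t)%N : nat)) cS.
under eq_bigr do rewrite modn_dvdm //.
exact: sum_residue_bounds.
Qed.

Lemma sum_residue_classes (I : finType) (P : pred I) (f : I -> nat) (g : nat) :
  (0 < g)%N ->
  (\sum_(t < g) \sum_(a in P) (f a %% g == t) = #|P|)%N.
Proof.
move=> hg; rewrite exchange_big /= -sum1_card; apply: eq_bigr => a _.
rewrite (bigD1 (Ordinal (ltn_pmod (f a) hg))) //= eqxx big1 // => t.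
by rewrite -val_eqE /= eq_sym => /negPf->.
Qed.

Lemma card_solution_set (m n : nat) (SA : {set 'I_m}) (SB : {set 'I_n}) :
  (0 < m)%N -> (0 < n)%N ->
  (\sum_(t < gcdn m n) (\sum_(a in SA) ((a : nat) %% gcdn m n == t)) *
                       (\sum_(b in SB) ((b : nat) %% gcdn m n == t))
     <= #|solution_set SA SB|)%N.
Proof.
move=> hm hn; set g := gcdn m n.
have hg : (0 < g)%N by rewrite gcdn_gt0 hm.
pose T := [set p : 'I_m * 'I_n |
  [&& p.1 \in SA, p.2 \in SB & p.1 == p.2 %[mod g]]].
have -> : (\sum_(t < g) (\sum_(a in SA) ((a : nat) %% g == t)) *
                        (\sum_(b in SB) ((b : nat) %% g == t)) = #|T|)%N.
  transitivity (\sum_(t < g) \sum_(p in T) ((p.1 : nat) %% g == t))%N.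
    apply: eq_bigr => t _; rewrite big_distrlr /= pair_big_dep /=.
    rewrite big_mkcond [RHS]big_mkcond; apply: eq_bigr => -[a b] _ /=.
    rewrite inE /=; case: (a \in SA); case: (b \in SB) => //=.
    case: (eqVneq (a %% g)%N t) => [->|_]; last by rewrite mul0n if_same.
    by rewrite mul1n eq_sym; case: eqP.
  exact: sum_residue_classes.
pose f (x : 'I_(m * n %/ g)) : 'I_m * 'I_n :=
  (Ordinal (ltn_pmod x hm), Ordinal (ltn_pmod x hn)).
(* It remains to lift each pair of [T] to a solution, that is, to show that [T] lies in the image of
   [solution_set SA SB] under [f]. *)
apply: leq_trans (leq_imset_card f _); apply/subset_leq_card/subsetP.
move=> [a b]; rewrite inE /= => /and3P[aSA bSB /eqP eq_ab].
have [x [xa xb]] := chinese_gcd hm hn eq_ab.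
have dvd_m : (m %| m * n %/ g)%N by rewrite -muln_divA ?dvdn_gcdr // dvdn_mulr.
have dvd_n : (n %| m * n %/ g)%N by rewrite mulnC -muln_divA ?dvdn_gcdl // dvdn_mulr.
have hl : (0 < m * n %/ g)%N.
  by rewrite divn_gt0 // dvdn_leq ?muln_gt0 ?hm // dvdn_mulr // dvdn_gcdl.
apply/imsetP; exists (Ordinal (ltn_pmod x hl)).
  rewrite inE; apply/existsP; exists a; rewrite aSA /=.
  apply/existsP; exists b; rewrite bSB /=.
  by rewrite !modn_dvdm // xa xb !eqxx.
by congr pair; apply: val_inj; rewrite /= modn_dvdm // ?xa ?xb modn_small.
Qed.

Lemma sum_mul_near_constant (g A rA B rB : nat) (al be : 'I_g -> nat) :
  (forall t, A <= al t <= A.+1)%N -> (forall t, B <= be t <= B.+1)%N ->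
  (\sum_t al t = A * g + rA)%N -> (\sum_t be t = B * g + rB)%N ->
  A%:Z * B%:Z * g%:Z + A%:Z * rB%:Z + B%:Z * rA%:Z
    + Num.max 0 (rA%:Z + rB%:Z - g%:Z)
  <= (\sum_t al t * be t)%N%:Z.
Proof.
move=> hal hbe sal sbe.
have sumZ (c : int) : \sum_(t < g) c = c * g%:Z.
  by rewrite sumr_const card_ord -mulr_natr natz.
move: (congr1 Posz sal) (congr1 Posz sbe); rewrite -!natz !natr_sum => sa sb.
have uv t : exists u v : bool, al t = (A + u)%N /\ be t = (B + v)%N.
  exists (al t == A.+1), (be t == B.+1); move: (hal t) (hbe t).
  by case: eqP; case: eqP; lia.
(* With [al t = A + u] and [be t = B + v], the product is [A * be t + B * al t - A * B + u * v], and
   [u * v >= e * (u + v - 1)] for [e] equal to 0 or 1. After summation, each [e] yields one argument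
   of the maximum. *)
have bound (e : int) : e = 0 \/ e = 1 ->
    \sum_(t < g) (A%:Z * (be t)%:R + B%:Z * (al t)%:R - A%:Z * B%:Z
      + e * ((al t)%:R - A%:Z + ((be t)%:R - B%:Z) - 1))
    <= \sum_(t < g) (al t * be t)%N%:R.
  move=> he; apply: ler_sum => t _.
  have [u [v [-> ->]]] := uv t; rewrite !natz.
  by case: he => ->; case: u; case: v; lia.
have [b0 b1] := (bound 0 (or_introl erefl), bound 1 (or_intror erefl)).
move: b0 b1; rewrite !(big_split, sumrN, =^~ mulr_sumr) /= sa sb !sumZ.
rewrite !natz; move: (\sum_(i < g) _) => s; lia.
Qed.

Theorem theorem2p2 (m n : nat) (hm : (0 < m)%N) (hn : (0 < n)%N)
  (SA : {set 'I_m}) (SB : {set 'I_n})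
  (hSA : residue_interval SA) (hSB : residue_interval SB)
  (g : nat) (hg : g = gcdn m n)
  (A rA B rB : nat)
  (hA : #|SA| = (A * g + rA)%N) (hrA : (rA < g)%N)
  (hB : #|SB| = (B * g + rB)%N) (hrB : (rB < g)%N) :
  A%:Z * B%:Z * g%:Z + A%:Z * rB%:Z + B%:Z * rA%:Z
    + Num.max 0 (rA%:Z + rB%:Z - g%:Z)
  <= #|solution_set SA SB|%:Z.
Proof.
have g0 : (0 < g)%N := leq_ltn_trans (leq0n rA) hrA.
apply: (@le_trans _ _ (\sum_(t < g)
    (\sum_(a in SA) ((a : nat) %% g == t)) *
    (\sum_(b in SB) ((b : nat) %% g == t)))%N%:Z); last first.
  by rewrite lez_nat hg; apply: card_solution_set.
apply: sum_mul_near_constant => [t|t||].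
- by apply: residue_interval_class_bounds hA _ _; rewrite // hg dvdn_gcdl.
- by apply: residue_interval_class_bounds hB _ _; rewrite // hg dvdn_gcdr.
- by rewrite sum_residue_classes.
- by rewrite sum_residue_classes.
Qed.
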